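(* Let $(F,G)=\{f_j,g_j\}_{j\in\mathbb{J}}$ be a dual frame pair for a Hilbert space $\mathcal{H}$, let $\Lambda\subset\mathbb{J}$ be an erasure set satisfying the minimal redundancy condition for $(F,G)$, and let $\Omega\subset\mathbb{J}\setminus\Lambda$ be a robust bridge set for $\Lambda$. Assume that the complex matrix $C=\left(\overline{c_j^{(k)}}\right)_{j\in\Omega,\,k\in\Lambda}$ solves the matrix equation $B(F,G,\Lambda,\Omega)\,C=B(F,G,\Lambda,\Lambda)$. For $f\in\mathcal{H}$ let $f_R=\sum_{j\in\mathbb{J}\setminus\Lambda}\langle f,g_j\rangle f_j$, $\alpha_j=\langle f,g_j\rangle$ and $\beta_j=\langle f_R,g_j\rangle$. Then for every $f\in\mathcal{H}$, $$(\langle f,g_j\rangle)_{j\in\Lambda}=C^T\big((\alpha_j)_{j\in\Omega}-(\beta_j)_{j\in\Omega}\big)+(\beta_j)_{j\in\Lambda},$$ where $C^T$ denotes the transpose of $C$ (and the tuples are viewed as column vectors).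
   Context: Inner products are linear in the first variable. $\mathbb{J}$ is a finite or countable index set. A frame for a Hilbert space $\mathcal{H}$ is a sequence $\{f_j\}_{j\in\mathbb{J}}$ in $\mathcal{H}$ for which there are constants $0<A\le B<\infty$ with $A\|f\|^2\le\sum_{j}|\langle f,f_j\rangle|^2\le B\|f\|^2$ for all $f\in\mathcal{H}$. A dual frame pair $(F,G)=\{f_j,g_j\}_{j\in\mathbb{J}}$ consists of frames $F=\{f_j\}$ and $G=\{g_j\}$ for $\mathcal{H}$ with $f=\sum_{j\in\mathbb{J}}\langle f,g_j\rangle f_j$ (norm convergence) for all $f\in\mathcal{H}$. An erasure set is a finite subset $\Lambda\subset\mathbb{J}$. It satisfies the minimal redundancy condition for the dual frame pair $(F,G)$ if $\overline{\mathrm{span}}\{g_j:j\notin\Lambda\}=\mathcal{H}$. A bridge set for $\Lambda$ is a finite set $\Omega\subset\mathbb{J}\setminus\Lambda$. For finite $\Lambda,\Omega\subset\mathbb{J}$ (with fixed enumerations), $B(F,G,\Lambda,\Omega)=(\langle f_j,g_k\rangle)_{j\in\Lambda,\,k\in\Omega}$ (rows indexed by $\Lambda$, columns by $\Omega$), and $B(F,G,\Lambda,\Lambda)=(\langle f_j,g_k\rangle)_{j,k\in\Lambda}$. A bridge set $\Omega$ is robust if the matrix equation $B(F,G,\Lambda,\Omega)C=B(F,G,\Lambda,\Lambda)$ has a solution $C$ (a complex matrix with rows indexed by $\Omega$ and columns by $\Lambda$). *)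

(* Defs.v *)
From HB Require Import structures.
From mathcomp Require Import all_boot all_order all_algebra finmap.
From mathcomp Require Import complex.
From mathcomp Require Import all_classical all_reals all_analysis.
From mathcomp Require Export showcase.summability.

Set Implicit Arguments.
Unset Strict Implicit.
Unset Printing Implicit Defensive.

Import Order.TTheory GRing.Theory Num.Theory.
Import numFieldNormedType.Exports.

Local Open Scope classical_set_scope.
Local Open Scope complex_scope.
Local Open Scope ring_scope.

(* The library's instance is local to a section. *)
#[export] Existing Instance totally_filter.

Section Frames.
Variables (R : realType) (H : completeNormedModType R[i]).
(* Forms of type {dot H for Num.conj} are linear in the first argument and
   conjugate-linear in the second. *)
Variable ip : {dot H for (@Num.conj R[i])}.

(* Ties the form to the norm of H, for which H is complete: this makes
   (H, ip) a Hilbert space. *)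
Definition induces_norm : Prop := forall u : H, `|u| ^+ 2 = ip u u.

Definition lspan (A : set H) : set H :=
  [set v | exists (n : nat) (a : 'I_n -> R[i]) (u : 'I_n -> H),
     (forall i, A (u i)) /\ v = \sum_(i < n) a i *: u i].

Variable J : countType.
Implicit Types (F G : J -> H) (Lambda Omega : {fset J}).

(* Norms are R[i]-valued, with values in the real axis, hence the real parts. *)
Definition frame F : Prop :=
  exists A B : R, [/\ 0 < A, A <= B &
    forall f : H,
      ((A * complex.Re `|f| ^+ 2)%:E <=
         \esum_(j in [set: J]) (complex.Re `|ip f (F j)| ^+ 2)%:E)%E /\
      (\esum_(j in [set: J]) (complex.Re `|ip f (F j)| ^+ 2)%:E <=
         (B * complex.Re `|f| ^+ 2)%:E)%E].

(* J carries no order: the series converges in norm along the net of finite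
   subsets of J, i.e. unconditionally.  For frames F and G this is equivalent
   to convergence along any one enumeration of J. *)
Definition dual_frame_pair F G : Prop :=
  [/\ frame F, frame G &
    forall f : H, partial_sum (fun j => ip f (G j) *: F j) @ totally --> f].

Definition minimal_redundancy G Lambda : Prop :=
  closure (lspan (G @` [set j | j \notin Lambda])) = [set: H].

Definition bridge_set Lambda Omega : Prop := [disjoint Omega & Lambda]%fset.

Definition enumerates n (s : n.-tuple J) (A : {fset J}) : Prop :=
  uniq s /\ (s =i A).

Definition bridge_mx F G m n (l : m.-tuple J) (o : n.-tuple J) :
    'M[R[i]]_(m, n) :=
  \matrix_(i < m, k < n) ip (F (tnth l i)) (G (tnth o k)).

(* l and o enumerate the erasure set and the bridge set. *)
Definition robust F G m n (l : m.-tuple J) (o : n.-tuple J) : Prop :=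
  exists C : 'M[R[i]]_(n, m), bridge_mx F G l o *m C = bridge_mx F G l l.

Definition partial_reconstruction F G Lambda (f : H) : H :=
  summability.sum (fun j => if j \in Lambda then 0 else ip f (G j) *: F j).

End Frames.

(* Main.v *)
Require Import Defs.
From HB Require Import structures.
From mathcomp Require Import all_boot all_order all_algebra finmap.
From mathcomp Require Import complex.
From mathcomp Require Import all_classical all_reals all_analysis.

Set Implicit Arguments.
Unset Strict Implicit.
Unset Printing Implicit Defensive.

Import Order.TTheory GRing.Theory Num.Theory.
Import numFieldNormedType.Exports.

Local Open Scope classical_set_scope.
Local Open Scope complex_scope.
Local Open Scope ring_scope.

(** Erasing the terms indexed by [Lambda] leaves a residual
    [f - fR = \sum_(j in Lambda) <f, g_j> f_j], a combination of the
    erased vectors [f_j] with the unknown numbers [<f, g_j>] as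
    coefficients.  The matrix equation [B(Lambda, Omega) C = B(Lambda,
    Lambda)] says, row by row, that on each erased [f_j] the functionals
    [< . , g_k>] with [k] in [Lambda] are the combinations, with coefficients
    the columns of [C], of the functionals with [k] in [Omega].  By linearity
    the same holds on [f - fR], that is,
    [alpha_Lambda - beta_Lambda = C^T (alpha_Omega - beta_Omega)], which
    rearranges to the claim.

    The formula for the residual rests on [cvg_partial_sum_erase]: finitely
    many terms can be removed from an unconditionally convergent series at the
    cost of their sum.  The transfer from [Omega] to [Lambda] is
    [bridge_mx_transfer]. *)

Lemma partial_sumE (I : choiceType) (V : zmodType) (x : I -> V) (A : {fset I}) :
  partial_sum x A = \sum_(j <- A) x j.
Proof. by rewrite /partial_sum -(big_seq_fsetE _ _ xpredT x). Qed.

(** A finite set [B] of indices that contains [A] splits into [A] and the rest,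
    so the two partial sums over [B] differ exactly by the sum over [A]; such
    [B] are cofinal among finite sets. *)
Lemma cvg_partial_sum_erase (K : numFieldType) (V : normedModType K)
    (I : choiceType) (x : I -> V) (s : V) (A : {fset I}) :
  partial_sum x @ totally --> s ->
  partial_sum (fun j => if j \in A then 0 else x j) @ totally
    --> s - \sum_(j <- A) x j.
Proof.
move=> xs.
apply: (@cvg_trans _ ((fun B => partial_sum x B - \sum_(j <- A) x j) @ totally)).
  apply: near_eq_cvg; exists A => //= B AB.
  rewrite !partial_sumE; apply/esym.
  rewrite [X in _ = X - _](bigID (mem A)) /=.
  have -> : \sum_(j <- B | j \in A) x j = \sum_(j <- A) x j.
    rewrite -big_filter; apply: perm_big.
    apply: uniq_perm; rewrite ?filter_uniq ?fset_uniq // => j.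
    by rewrite mem_filter; case: (boolP (j \in A)) => //= /(fsubsetP AB).
  rewrite addrAC subrr add0r [RHS]big_mkcond /=; apply: eq_bigr => j _.
  by case: (j \in A).
by apply: cvgB => //; exact: cvg_cst.
Qed.

Lemma sub_partial_reconstruction (R : realType)
    (H : completeNormedModType R[i]) (ip : {dot H for (@Num.conj R[i])})
    (J : countType) (F G : J -> H) (Lambda : {fset J}) (f : H) :
  partial_sum (fun j => ip f (G j) *: F j) @ totally --> f ->
  f - partial_reconstruction ip F G Lambda f =
    \sum_(j <- Lambda) ip f (G j) *: F j.
Proof.
move=> /(cvg_partial_sum_erase (A := Lambda)) fR_cvg.
by rewrite /partial_reconstruction /summability.sum
  (cvg_lim (@norm_hausdorff _ H) fR_cvg) subKr.
Qed.

(** The row of values [<v, g_k>] is the coordinate row [a] times the bridge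
    matrix, so multiplying the matrix equation by [a] on the left expresses one
    row of values through the other; written with columns, this is [C^T]. *)
Lemma bridge_mx_transfer (R : realType)
    (H : completeNormedModType R[i]) (ip : {dot H for (@Num.conj R[i])})
    (J : countType) (F G : J -> H) (m n p : nat)
    (l : m.-tuple J) (o : n.-tuple J) (q : p.-tuple J) (C : 'M[R[i]]_(n, p))
    (a : 'I_m -> R[i]) :
  bridge_mx ip F G l o *m C = bridge_mx ip F G l q ->
  let v := \sum_(i < m) a i *: F (tnth l i) in
  \col_(k < p) ip v (G (tnth q k)) = C^T *m \col_(k < n) ip v (G (tnth o k)).
Proof.
move=> BC v.
have ip_v r (t : r.-tuple J) :
    \col_(k < r) ip v (G (tnth t k)) = (\row_i a i *m bridge_mx ip F G l t)^T.
  apply/matrixP => k z; rewrite !mxE linear_sumlz; apply: eq_bigr => i _.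
  by rewrite linearZl_LR !mxE.
by rewrite !ip_v -trmx_mul -mulmxA BC.
Qed.

Theorem theorem3p5 (R : realType) (H : completeNormedModType R[i])
    (ip : {dot H for (@Num.conj R[i])}) (ip_norm : induces_norm ip)
    (J : countType) (F G : J -> H) (FG : dual_frame_pair ip F G)
    (Lambda Omega : {fset J}) (m n : nat)
    (l : m.-tuple J) (l_enum : enumerates l Lambda)
    (o : n.-tuple J) (o_enum : enumerates o Omega)
    (Lambda_red : minimal_redundancy G Lambda)
    (Omega_bridge : bridge_set Lambda Omega)
    (Omega_robust : robust ip F G l o)
    (C : 'M[R[i]]_(n, m))
    (C_sol : bridge_mx ip F G l o *m C = bridge_mx ip F G l l)
    (f : H) :
  let fR := partial_reconstruction ip F G Lambda f in
  let alpha := fun j : J => ip f (G j) in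
  let beta := fun j : J => ip fR (G j) in
  \col_(i < m) ip f (G (tnth l i)) =
    C^T *m (\col_(i < n) alpha (tnth o i) - \col_(i < n) beta (tnth o i))
    + \col_(i < m) beta (tnth l i).
Proof.
move=> fR alpha beta.
have [_ _ dual] := FG; have [l_uniq l_mem] := l_enum.
have res : f - fR = \sum_(i < m) alpha (tnth l i) *: F (tnth l i).
  rewrite (sub_partial_reconstruction _ (dual f)).
  rewrite -(big_tuple _ _ l xpredT (fun j => alpha j *: F j)).
  by apply: perm_big; apply: uniq_perm; rewrite ?fset_uniq // => j; rewrite l_mem.
have colB r (t : r.-tuple J) :
    \col_(k < r) ip (f - fR) (G (tnth t k)) =
    \col_(k < r) alpha (tnth t k) - \col_(k < r) beta (tnth t k).
  by apply/matrixP => k z; rewrite !mxE linearBl.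
by rewrite -colB res -(bridge_mx_transfer _ C_sol) -res colB subrK.
Qed.
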